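(* Let $d, d_1$ be integers with $2 \leq d_1 < d/2$ and set $d_2 = d-1-d_1$. Consider the irreducible curve $C : f=0$ of degree $d$ in $\mathbb{P}^2$ (over $\mathbb{C}$) given by $$f(x,y,z)= x^d+x^{d_1}y^{d_2+1}+y^{d-1}z.$$ Then the following holds. (1) The curve $C$ is free with exponents $(d_1,d_2)$. (2) The curve $C$ is rational and has a unique cusp, which has a unique Puiseux pair, namely $(d-1,d)$.
   Context: Let $S=\mathbb{C}[x,y,z]$ with its standard grading. For a reduced curve $C:f=0$ of degree $d$ in $\mathbb{P}^2$, with $f\in S$ homogeneous of degree $d$ and partial derivatives $f_x,f_y,f_z$, let $AR(f)=\{(a,b,c)\in S^3 : af_x+bf_y+cf_z=0\}$ be the graded $S$-module of Jacobian syzygies; a homogeneous syzygy has degree $m$ if $a,b,c$ are homogeneous of degree $m$. The curve $C$ is free with exponents $(d_1,d_2)$, $d_1\le d_2$, if $AR(f)$ is a free graded $S$-module of rank 2 with a homogeneous basis consisting of syzygies of degrees $d_1$ and $d_2$; then necessarily $d_1+d_2=d-1$. A cusp is a unibranch (locally irreducible) singular point of a plane curve; having a unique cusp means that the singular locus of $C$ is a single point and $C$ is unibranch there. A cusp has the unique Puiseux pair $(p,q)$, with $p<q$ coprime, if its germ is topologically equivalent to the germ $u^p=v^q$ at the origin of $\mathbb{C}^2$. *)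

(* Defs.v *)
From mathcomp Require Import all_boot all_order all_algebra.
From mathcomp Require Import mpoly complex.
From mathcomp Require Import boolp classical_sets reals topology normedtype.

Set Implicit Arguments.
Unset Strict Implicit.
Unset Printing Implicit Defensive.

Import Order.TTheory GRing.Theory Num.Theory.

Local Open Scope classical_set_scope.
Local Open Scope complex_scope.
Local Open Scope ring_scope.

Section Algebra.
Variable K : fieldType.

Definition irreducible_mpoly n (f : {mpoly K[n]}) : Prop :=
  [/\ f != 0, f \isn't a GRing.unit
    & forall g h : {mpoly K[n]},
        f = g * h -> g \is a GRing.unit \/ h \is a GRing.unit].

(* A Jacobian syzygy (a, b, c) is the row vector with these entries. *)
Definition AR (f : {mpoly K[3]}) (a : 'rV[{mpoly K[3]}]_3) : Prop :=
  \sum_(i < 3) a 0 i * f^`M(i) = 0.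

Definition homog_vec n m (k : nat) (a : 'rV[{mpoly K[n]}]_m) : Prop :=
  forall i, a 0 i \is k.-homog.

Definition free_with_exponents (f : {mpoly K[3]}) (d1 d2 : nat) : Prop :=
  (d1 <= d2)%N /\
  exists r1 r2 : 'rV[{mpoly K[3]}]_3,
    [/\ AR f r1, homog_vec d1 r1, AR f r2, homog_vec d2 r2
      & forall a, AR f a ->
          exists! c : {mpoly K[3]} * {mpoly K[3]}, a = c.1 *: r1 + c.2 *: r2].

(* A closed irreducible subvariety of P^(n-1) is given by its homogeneous
   ideal, as a predicate on {mpoly K[n]}: the ideal [zero_ideal] gives the
   whole projective space, and [principal_ideal f] the hypersurface f = 0
   when f is irreducible. *)
Definition zero_ideal n (g : {mpoly K[n]}) : Prop := g = 0.

Definition principal_ideal n (f g : {mpoly K[n]}) : Prop :=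
  exists h, g = h * f.

(* F represents a rational map V(I) --> V(J): its components are forms of the
   same degree, not all vanishing identically on V(I), and the image lies in
   V(J). *)
Definition rational_map n m (I : {mpoly K[n]} -> Prop)
    (J : {mpoly K[m]} -> Prop) (F : m.-tuple {mpoly K[n]}) : Prop :=
  [/\ exists k, forall i, tnth F i \is k.-homog,
      exists i, ~ I (tnth F i)
    & forall g, J g -> I (g \mPo F)].

Definition comp_tuple n m p (G : p.-tuple {mpoly K[m]})
    (F : m.-tuple {mpoly K[n]}) : p.-tuple {mpoly K[n]} :=
  [tuple (tnth G i) \mPo F | i < p].

(* F = (F_0 : ... : F_(n-1)) is defined and equal to (X_0 : ... : X_(n-1)) at
   the generic point of V(I). *)
Definition identity_map n (I : {mpoly K[n]} -> Prop)
    (F : n.-tuple {mpoly K[n]}) : Prop :=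
  (exists i, ~ I (tnth F i)) /\
  forall i j, I (tnth F i * 'X_j - tnth F j * 'X_i).

Definition birational n m (I : {mpoly K[n]} -> Prop)
    (J : {mpoly K[m]} -> Prop) : Prop :=
  exists (F : m.-tuple {mpoly K[n]}) (G : n.-tuple {mpoly K[m]}),
    [/\ rational_map I J F, rational_map J I G,
        identity_map I (comp_tuple G F) & identity_map J (comp_tuple F G)].

Definition rational_curve (f : {mpoly K[3]}) : Prop :=
  birational (@zero_ideal 2) (principal_ideal f).

(* Points of P^2 are given by nonzero vectors of homogeneous coordinates. *)
Definition singular_point (f : {mpoly K[3]}) (P : 'rV[K]_3) : Prop :=
  [/\ P != 0, f.@[P 0] = 0 & forall k, f^`M(k).@[P 0] = 0].

(* Equation of the curve f = 0 in the affine chart P_i <> 0, with the two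
   affine coordinates translated so that P becomes the origin. *)
Definition local_equation (f : {mpoly K[3]}) (P : 'rV[K]_3) (i : 'I_3) :
    {mpoly K[2]} :=
  f \mPo [tuple (if unlift i j is Some k then 'X_k + (P 0 j / P 0 i)%:MP else 1)
         | j < 3].

Definition taylor2 (g : {mpoly K[2]}) (k l : nat) : K :=
  g@_[multinom (if j == ord0 then k else l) | j < 2].

End Algebra.

Section ConvergentSeries.
Variable K : numFieldType.

(* [a k l] is the coefficient of u^k v^l. *)
Definition convergent (a : nat -> nat -> K) : Prop :=
  exists M r : K, 0 < r /\ forall k l, `|a k l| * r ^+ (k + l) <= M.

Definition mul_series (a b : nat -> nat -> K) (k l : nat) : K :=
  \sum_(i < k.+1) \sum_(j < l.+1) a i j * b (k - i)%N (l - j)%N.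

(* Irreducibility in the local ring K{u,v}, whose non-units are the series
   with zero constant term (the zero series is excluded by 0 = 0 * 0). *)
Definition irreducible_germ (a : nat -> nat -> K) : Prop :=
  [/\ convergent a, a 0%N 0%N = 0
    & forall b c, convergent b -> convergent c ->
        (forall k l, a k l = mul_series b c k l) ->
        b 0%N 0%N != 0 \/ c 0%N 0%N != 0].

End ConvergentSeries.

Definition unibranch (K : numFieldType) (f : {mpoly K[3]}) (P : 'rV[K]_3) :
    Prop :=
  forall i, P 0 i != 0 -> irreducible_germ (taylor2 (local_equation f P i)).

Definition unique_cusp (K : numFieldType) (f : {mpoly K[3]}) (P : 'rV[K]_3) :
    Prop :=
  [/\ singular_point f P,
      forall Q, singular_point f Q -> exists c : K, Q = c *: P
    & unibranch f P].

(* Topological equivalence of the embedded germs (S, A, a) and (T, B, b). *)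
Definition germ_top_equiv (S T : topologicalType) (A : set S) (a : S)
    (B : set T) (b : T) : Prop :=
  exists (U : set S) (V : set T) (h : S -> T) (k : T -> S),
    [/\ open U /\ U a, open V /\ V b,
        [/\ {within U, continuous h}, {within V, continuous k},
            h @` U = V, k @` V = U & {in U, cancel h k}],
        h a = b
      & h @` (A `&` U) = B `&` V].

Section TopologicalType.
Variable R : realType.

(* R[i]^o is R[i] with the metric topology given by the complex modulus. *)
Definition zero_locus (g : {mpoly R[i][2]}) : set 'rV[R[i]^o]_2 :=
  [set w | g.@[w 0] = 0].

Definition unique_puiseux_pair (f : {mpoly R[i][3]}) (P : 'rV[R[i]]_3)
    (p q : nat) : Prop :=
  [/\ (p < q)%N, coprime p q
    & forall i, P 0 i != 0 ->
        germ_top_equiv (zero_locus (local_equation f P i)) 0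
          (zero_locus ('X_0 ^+ p - 'X_1 ^+ q)) 0].

End TopologicalType.

(* Main.v *)
(* Freeness.  One has [f_y = y^d2 Q] and [f_z = y^d2 y^d1] with [y] not dividing
   [Q], so [syz1 = (0, y^d1, -Q)] is a syzygy; another one, [syz2], has first
   entry a constant times [y^d2].  If [(a, b, c)] is a syzygy, then [y^d2]
   divides [a f_x], hence [a], as [y] does not divide [f_x]; subtracting a
   multiple of [syz2] one may assume [a = 0], and then [b Q + c y^d1 = 0] yields
   a multiple of [syz1].

   Rationality.  [f] has degree one in [z], so solving for [z] parametrizes the
   curve by [(x : y)].

   The cusp.  The only singular point is [(0 : 0 : 1)], with local equation
   [u^d + u^d1 v^e + v^(d-1)], [e = d2 + 1].  Its Newton polygon has one edge,
   without inner lattice points, so the germ is irreducible.  On the curve near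
   the origin [v / u] is small, and the equation reads
   [v^(d-1) = - u^d (1 + (v/u)^e)]: rescaling both coordinates by a function
   [s(v/u)] preserves [v/u] and turns this into [v^(d-1) = - u^d] if
   [s = 1 + (v/u)^e].  Away from the curve [s] can be replaced by any continuous
   function of [(u : v)] with values near [1], so this is a homeomorphism. *)

From HB Require Import structures.
Require Import Defs.
From mathcomp Require Import all_boot all_order all_algebra.
From mathcomp Require Import ring zify.
From mathcomp Require Import mpoly complex.
From mathcomp Require Import boolp classical_sets reals topology normedtype.

Set Implicit Arguments.
Unset Strict Implicit.
Unset Printing Implicit Defensive.

Import Order.TTheory GRing.Theory Num.Theory.
Import numFieldNormedType.Exports.

Local Open Scope classical_set_scope.
Local Open Scope ring_scope.

Lemma ord3P (P : 'I_3 -> Prop) : P 0 -> P 1 -> P 2 -> forall i, P i.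
Proof.
move=> H0 H1 H2 [[|[|[|//]]] Hi].
- by rewrite (_ : Ordinal Hi = 0) //; apply: val_inj.
- by rewrite (_ : Ordinal Hi = 1) //; apply: val_inj.
- by rewrite (_ : Ordinal Hi = 2) //; apply: val_inj.
Qed.

Lemma ord2P (P : 'I_2 -> Prop) : P 0 -> P 1 -> forall i, P i.
Proof.
move=> H0 H1 [[|[|//]] Hi].
- by rewrite (_ : Ordinal Hi = 0) //; apply: val_inj.
- by rewrite (_ : Ordinal Hi = 1) //; apply: val_inj.
Qed.

(** * Reduction modulo a variable, and irreducibility of polynomials of degree one in a variable *)

Section MPoly.

Lemma comp_mpolyM n m (R : comNzRingType) (t : n.-tuple {mpoly R[m]}) p q :
  (p * q) \mPo t = (p \mPo t) * (q \mPo t).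
Proof. exact: rmorphM. Qed.

Lemma comp_mpolyXn n m (R : comNzRingType) (t : n.-tuple {mpoly R[m]}) p k :
  (p ^+ k) \mPo t = (p \mPo t) ^+ k.
Proof. exact: rmorphXn. Qed.

Variable K : fieldType.

Lemma mderivXU n (i j : 'I_n) : ('X_j : {mpoly K[n]})^`M(i) = (j == i)%:R.
Proof.
rewrite mderivX mnm1E; case: eqVneq => [->|_]; last by rewrite scale0r.
rewrite scale1r (_ : (_ - _)%MM = 0%MM) ?mpolyX0 //.
by apply/mnmP => l; rewrite mnmBE subnn mnm0E.
Qed.

Lemma mderivXn n (i : 'I_n) (p : {mpoly K[n]}) k :
  (p ^+ k)^`M(i) = p ^+ k.-1 * p^`M(i) *+ k.
Proof.
elim: k => [|k IHk]; first by rewrite mulr0n expr0 -mpolyC1 mderivC.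
rewrite exprS mderivM IHk /= mulrS [p^`M(i) * _]mulrC; congr (_ + _).
case: k {IHk} => [|k]; first by rewrite !mulr0n mulr0.
by rewrite mulrnAr exprS mulrA.
Qed.

Lemma mpolyXU_neq0 n (i : 'I_n) : 'X_i != 0 :> {mpoly K[n]}.
Proof. by rewrite -mleadc_eq0 mleadXm mcoeffX eqxx oner_neq0. Qed.

Lemma dhomogXn n (i : 'I_n) k : ('X_i ^+ k : {mpoly K[n]}) \is k.-homog.
Proof.
rewrite -[k in k.-homog]mul1n dhomogMn // dhomogX; apply/eqP; exact: mdeg1.
Qed.

(** Composition with [zero_at i] is reduction modulo ['X_i], with values in the same ring; that
    ['X_i] does not divide [q] is expressed as [q \mPo zero_at i != 0]. *)
Definition zero_at n (i : 'I_n) : n.-tuple {mpoly K[n]} :=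
  [tuple if j == i then 0 else 'X_j | j < n].

Lemma comp_zero_atX n (i j : 'I_n) :
  'X_j \mPo zero_at i = if j == i then 0 else 'X_j.
Proof. by rewrite comp_mpolyXU -tnth_nth tnth_mktuple. Qed.

(** By linearity it suffices to treat monomials, and each of them is either fixed by the
    substitution or divisible by ['X_i]. *)
Lemma mpoly_eq_zero_at_add n (i : 'I_n) (p : {mpoly K[n]}) :
  exists q, p = p \mPo zero_at i + 'X_i * q.
Proof.
elim/mpolyind: p => [|c m p _ _ [q IHq]].
  by exists 0; rewrite comp_mpoly0 mulr0 addr0.
suff [r Hr] : exists r, 'X_[m] = 'X_[m] \mPo zero_at i + 'X_i * r.
  exists (c *: r + q); rewrite comp_mpolyD comp_mpolyZ {1}Hr {1}IHq.
  by rewrite scalerDr mulrDr -scalerAr addrACA.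
have [mi0|mi0] := eqVneq (m i) 0%N.
  exists 0; rewrite mulr0 addr0 comp_mpolyX {1}mpolyXE_id.
  apply: eq_bigr => j _; rewrite tnth_mktuple.
  by case: eqVneq => // ->; rewrite mi0 !expr0.
exists 'X_[m - U_(i)]; rewrite -mpolyXD addmC submK; last first.
  by rewrite lep1mP.
rewrite comp_mpolyX (bigD1 i) //= tnth_mktuple eqxx expr0n (negPf mi0).
by rewrite mul0r add0r.
Qed.

(** The variable ['X_i] is prime: it generates the kernel of the substitution, a morphism to an
    integral domain. *)
Lemma dvd_mpolyX_mul n (i : 'I_n) (p q r : {mpoly K[n]}) :
  q \mPo zero_at i != 0 -> p * q = 'X_i * r -> exists p', p = 'X_i * p'.
Proof.
move=> q0 pqr; have [p' Hp] := mpoly_eq_zero_at_add i p; exists p'.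
suff p0 : p \mPo zero_at i = 0 by rewrite {1}Hp p0 add0r.
apply: (mulIf q0); rewrite mul0r -rmorphM /= pqr rmorphM /=.
by rewrite comp_zero_atX eqxx mul0r.
Qed.

Lemma dvd_mpolyXn_mul n (i : 'I_n) k (p q r : {mpoly K[n]}) :
  q \mPo zero_at i != 0 -> p * q = 'X_i ^+ k * r ->
  exists p', p = 'X_i ^+ k * p'.
Proof.
move=> q0; elim: k p r => [|k IHk] p r pqr; first by exists p; rewrite mul1r.
have [p' Hp] : exists p', p = 'X_i * p'.
  by apply: (dvd_mpolyX_mul (r := 'X_i ^+ k * r) q0); rewrite pqr exprS mulrA.
have /IHk[p'' Hp'] : p' * q = 'X_i ^+ k * r.
  by apply: (mulfI (mpolyXU_neq0 i)); rewrite !mulrA -Hp -exprS.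
by exists p''; rewrite Hp Hp' exprS mulrA.
Qed.

Lemma mpoly_rmorph_eq n (S : comNzRingType) (f g : {rmorphism {mpoly K[n]} -> S}) :
  (forall c, f c%:MP = g c%:MP) -> (forall j, f 'X_j = g 'X_j) -> f =1 g.
Proof.
move=> fgC fgX; elim/mpolyind => [|c m p _ _ IHp]; first by rewrite !rmorph0.
rewrite !rmorphD IHp -mul_mpolyC !rmorphM fgC; congr (_ * _ + _).
rewrite mpolyXE_id !rmorph_prod; apply: eq_bigr => j _.
by rewrite !rmorphXn /= fgX.
Qed.

(* Grading by the degree in ['X_i]: substitute ['X_i * T] for ['X_i]. *)
Lemma mpoly_tag_var n (i : 'I_n) :
  exists t : {rmorphism {mpoly K[n]} -> {poly {mpoly K[n]}}},
  [/\ forall p, (t p).[1] = p, forall p, (t p).[0] = p \mPo zero_at i,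
      forall p, t (p \mPo zero_at i) = (p \mPo zero_at i)%:P
    & t 'X_i = ('X_i)%:P * 'X].
Proof.
pose h j := if j == i then ('X_j)%:P * 'X else ('X_j)%:P : {poly {mpoly K[n]}}.
pose t : {rmorphism {mpoly K[n]} -> {poly {mpoly K[n]}}} :=
  mmap (polyC \o @mpolyC n K) h.
have tX j : t 'X_j = h j by rewrite /t /= mmapX mmap1U.
have tC c : t c%:MP = c%:MP%:P by rewrite /t /= mmapC.
exists t; split; last by rewrite tX /h eqxx.
- apply: (mpoly_rmorph_eq (f := horner_eval 1 \o t) (g := idfun)).
    by move=> c; rewrite /= tC /horner_eval hornerC.
  move=> j; rewrite [LHS]/= tX /horner_eval /h.
  by case: eqP => _; rewrite !hornerE.
- apply: (mpoly_rmorph_eq (f := horner_eval 0 \o t) (g := comp_mpoly (zero_at i))).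
    by move=> c; rewrite /= tC /horner_eval hornerC comp_mpolyC.
  move=> j; change ((t 'X_j).[0] = 'X_j \mPo zero_at i).
  rewrite tX comp_zero_atX /h.
  by case: eqP => _; rewrite !hornerE.
apply: (mpoly_rmorph_eq (f := t \o comp_mpoly (zero_at i))
                       (g := polyC \o comp_mpoly (zero_at i))).
  by move=> c; change (t (c%:MP \mPo zero_at i) = (c%:MP \mPo zero_at i)%:P);
    rewrite comp_mpolyC tC.
move=> j; change (t ('X_j \mPo zero_at i) = ('X_j \mPo zero_at i)%:P).
rewrite comp_zero_atX.
by case: ifP => ji; rewrite ?rmorph0 // tX /h ji.
Qed.

(** As [f] has degree one in ['X_i], one of any two factors, say [g], is free of ['X_i]. Then [g]
    divides both [A] and ['X_j ^+ k.+1 * 'X_i]; neither variable divides [g], so [g] is a unit. *)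
Lemma irreducible_mpolyXn_mulX_add n (i j : 'I_n) k (A f : {mpoly K[n]}) :
  i != j -> A \mPo zero_at i = A -> A \mPo zero_at j != 0 ->
  f = A + 'X_j ^+ k.+1 * 'X_i -> irreducible_mpoly f.
Proof.
move=> ij Ai Aj fE.
have [t [t1 t0 tz tX]] := mpoly_tag_var i.
have X0 := @mpolyXU_neq0 n; have Xz := @comp_zero_atX n.
have fi : f \mPo zero_at i = A.
  by rewrite fE rmorphD rmorphM /= Xz eqxx mulr0 addr0.
have fj : f \mPo zero_at j != 0.
  by rewrite fE rmorphD rmorphM rmorphXn /= Xz eqxx expr0n mul0r addr0.
have f0 : f != 0 by apply: contra_neq fj => ->; rewrite rmorph0.
have sf : size (t f) = 2%N.
  have Bf : t f = ('X_j ^+ k.+1 * 'X_i)%:P * 'X + A%:P.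
    rewrite fE rmorphD rmorphM rmorphXn /= tX (_ : t 'X_j = ('X_j)%:P).
      by rewrite -[in t A]Ai tz Ai addrC mulrA -rmorphXn -rmorphM.
    by have := tz 'X_j; rewrite Xz eq_sym (negPf ij).
  rewrite Bf size_MXaddC polyC_eq0 (negPf (mulf_neq0 _ _)) ?expf_neq0 //=.
  by rewrite size_polyC mulf_neq0 ?expf_neq0.
(* Here [size (t g) = 1] says that [g] has degree zero in ['X_i]. *)
have main g h : size (t g) = 1%N -> f = g * h -> g \is a GRing.unit.
  move=> sg fgh.
  have gi : g \mPo zero_at i = g.
    by rewrite -t0 -[RHS]t1; move/eqP/size_poly1P: sg => [c _ ->]; rewrite !hornerC.
  have Agh : A = g * (h \mPo zero_at i) by rewrite -fi fgh rmorphM /= gi.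
  have gh : (h - (h \mPo zero_at i)) * g = 'X_j ^+ k.+1 * 'X_i.
    by rewrite mulrBl [h * g]mulrC [_ * g]mulrC -fgh -Agh fE addrC addKr.
  have gj : g \mPo zero_at j != 0.
    by apply: contra_neq fj => g0; rewrite fgh rmorphM /= g0 mul0r.
  have [r rE] := dvd_mpolyXn_mul gj gh.
  have rg : r * g = 'X_i * 1.
    apply: (mulfI (expf_neq0 k.+1 (X0 j))).
    by rewrite mulr1 -gh rE mulrA.
  have gi0 : g \mPo zero_at i != 0.
    by rewrite gi; apply: contra_neq f0 => g0; rewrite fgh g0 mul0r.
  have [s sE] := dvd_mpolyX_mul gi0 rg.
  apply/unitrP; exists s; suff : s * g = 1 by rewrite [g * s]mulrC.
  by apply: (mulfI (X0 i)); rewrite mulr1 -[RHS]mulr1 -rg sE mulrA.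
split; first exact: f0.
  apply/negP => /unitrP[f' [_ ff']].
  have tff' : t f * t f' = 1 by rewrite -[RHS](rmorph1 t) -ff' rmorphM.
  by have := size_mul_eq1 (t f) (t f'); rewrite tff' size_poly1 eqxx sf.
move=> g h fgh.
have tgh : t g * t h = t f by rewrite fgh rmorphM.
have tf0 : t f != 0 by rewrite -size_poly_eq0 sf.
have := tf0; rewrite -tgh mulf_eq0 negb_or => /andP[g0 h0].
have : (size (t g) + size (t h)).-1 = 2%N.
  by rewrite -size_mul // tgh sf.
rewrite -!size_poly_eq0 in g0 h0; move=> E.
have [sg|sh] : size (t g) = 1%N \/ size (t h) = 1%N.
- move: g0 h0 E; set a := size (t g); set b := size (t h); clearbody a b; lia.
- by left; apply: main fgh.
- by right; apply: main (etrans fgh (mulrC _ _)).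
Qed.

End MPoly.

(** * Newton polygons of products of power series *)

Section NewtonPolygon.
Variable K : numFieldType.
Implicit Types (a b c : nat -> nat -> K) (w t : nat * nat).

Definition wt w (k l : nat) : nat := (w.1 * k + w.2 * l)%N.

Lemma wt_sub w i j k l : (i <= k)%N -> (j <= l)%N ->
  (wt w i j + wt w (k - i) (l - j) = wt w k l)%N.
Proof. by rewrite /wt => ik jl; rewrite addnACA -!mulnDr !subnKC. Qed.

Lemma wtD w i j k l : wt w (i + k) (j + l) = (wt w i j + wt w k l)%N.
Proof. by rewrite /wt !mulnDr addnACA. Qed.

(** When [w] and [t] are linearly independent this is a vertex of the Newton polygon: [w] selects a
    face and [t] one of its ends. *)
Definition lex_min w t a (k0 l0 : nat) : Prop :=
  [/\ a k0 l0 != 0, forall k l, a k l != 0 -> (wt w k0 l0 <= wt w k l)%N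
    & forall k l, a k l != 0 -> wt w k l = wt w k0 l0 -> (wt t k0 l0 <= wt t k l)%N].

Lemma ex_lex_min w t a k l : a k l != 0 -> exists k0 l0, lex_min w t a k0 l0.
Proof.
move=> akl.
have [|N /asboolP[k1 [l1 [a1 w1]]] Nmin] :=
    @ex_minnP (fun N => `[< exists i j, a i j != 0 /\ wt w i j = N >]).
  by exists (wt w k l); apply/asboolP; exists k, l.
have [|T /asboolP[k2 [l2 [a2 w2 t2]]] Tmin] :=
    @ex_minnP (fun T => `[< exists i j, [/\ a i j != 0, wt w i j = N & wt t i j = T] >]).
  by exists (wt t k1 l1); apply/asboolP; exists k1, l1.
exists k2, l2; split=> // i j aij; rewrite w2.
  by apply: Nmin; apply/asboolP; exists i, j.
by move=> wij; rewrite t2; apply: Tmin; apply/asboolP; exists i, j.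
Qed.

Lemma mul_series_neq0 b c k l : mul_series b c k l != 0 ->
  exists i j, [/\ (i <= k)%N, (j <= l)%N, b i j != 0 & c (k - i)%N (l - j)%N != 0].
Proof.
apply: contra_neqP => H; rewrite /mul_series.
apply: big1 => i _; apply: big1 => j _; apply/eqP; rewrite mulf_eq0.
apply/negPn/negP; rewrite negb_or => /andP[bij cij]; apply: H.
by exists i, j; split=> //; [exact: (ltn_ord i)|exact: (ltn_ord j)].
Qed.

(** Weights add under multiplication, so a nonzero term of this convolution has minimal [w]-weight,
    then minimal [t]-weight, in both factors. By independence of [w] and [t] these weights determine
    the exponents, and a single term survives. *)
Lemma mul_series_lex_min w t b c k1 l1 k2 l2 : (w.1 * t.2 != w.2 * t.1)%N ->
  lex_min w t b k1 l1 -> lex_min w t c k2 l2 ->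
  mul_series b c (k1 + k2)%N (l1 + l2)%N != 0.
Proof.
move=> wt0 [b1 bw bt] [c2 cw ct].
suff -> : mul_series b c (k1 + k2) (l1 + l2) = b k1 l1 * c k2 l2 by rewrite mulf_neq0.
have k1P : (k1 < (k1 + k2).+1)%N by lia.
have l1P : (l1 < (l1 + l2).+1)%N by lia.
have main i j : (i <= k1 + k2)%N -> (j <= l1 + l2)%N ->
    (i != k1) || (j != l1) -> b i j * c (k1 + k2 - i)%N (l1 + l2 - j)%N = 0.
  move=> ik jl ij; apply/eqP; rewrite mulf_eq0; apply/negPn/negP.
  rewrite negb_or => /andP[bij cij].
  have Ww := wt_sub w ik jl; have Wt := wt_sub t ik jl; rewrite !wtD in Ww Wt.
  have w1 := bw _ _ bij; have w2 := cw _ _ cij.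
  have e1 : wt w i j = wt w k1 l1 by lia.
  have e2 : wt w (k1 + k2 - i) (l1 + l2 - j) = wt w k2 l2 by lia.
  have t1 := bt _ _ bij e1; have t2 := ct _ _ cij e2.
  have e3 : wt t i j = wt t k1 l1 by lia.
  move: wt0 ij e1 e3; rewrite /wt.
  case: w t {b1 bw bt c2 cw ct Ww Wt w1 w2 e2 t1 t2} => [w1 w2] [t1 t2] /=.
  move=> wt0 ij e1 e3.
  (* Cramer's rule: the determinant of [w] and [t] kills both differences of exponents. *)
  have : ((w1 * t2)%:Z - (w2 * t1)%:Z) * (i%:Z - k1%:Z) = 0 by nia.
  have : ((w1 * t2)%:Z - (w2 * t1)%:Z) * (j%:Z - l1%:Z) = 0 by nia.
  move=> /eqP; rewrite mulf_eq0 => /orP[|/eqP Hj]; first by lia.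
  move=> /eqP; rewrite mulf_eq0 => /orP[|/eqP Hi]; lia.
rewrite /mul_series (bigD1 (Ordinal k1P)) //= (bigD1 (Ordinal l1P)) //=.
rewrite !addKn !big1 ?addr0 // => [i /eqP ik|j /eqP jl].
  apply: big1 => j _; apply: main; [exact: (ltn_ord i)|exact: (ltn_ord j)|].
  by apply/orP; left; apply/eqP => E; apply: ik; apply: val_inj.
rewrite -[X in c X _](addKn k1 k2); apply: main; [exact: leq_addr|exact: (ltn_ord j)|].
by apply/orP; right; apply/eqP => E; apply: jl; apply: val_inj.
Qed.

(* The Newton polygon of such a germ has the single edge from [(0, p)] to
   [(q, 0)], which carries no other lattice point, so it has no nontrivial
   Minkowski decomposition. *)
Lemma irreducible_germ_newton p q a : (0 < p)%N -> (0 < q)%N -> coprime p q ->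
  convergent a -> a 0%N p != 0 -> a q 0%N != 0 ->
  (forall k l, a k l != 0 ->
     [\/ k = 0%N /\ l = p, k = q /\ l = 0%N | (p * q < p * k + q * l)%N]) ->
  irreducible_germ a.
Proof.
move=> p0 q0 pq ca a0p aq0 aN; split=> //.
  apply/eqP; apply: contraT => /aN[[_ E]|[E _]|]; lia.
move=> b c _ _ abc.
(* A nonzero coefficient of [a] shows that [b] and [c] are nonzero, so that both have lexicographic
   minima. *)
have [i1 [j1 [_ _ b1 c1]]] : exists i j,
    [/\ (i <= 0)%N, (j <= p)%N, b i j != 0 & c (0 - i)%N (p - j)%N != 0].
  by apply: mul_series_neq0; rewrite -abc.
have key t : (p * t.2 != q * t.1)%N -> exists k1 l1 k2 l2,
    [/\ lex_min (p, q) t b k1 l1, lex_min (p, q) t c k2 l2,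
      a (k1 + k2)%N (l1 + l2)%N != 0 &
      forall k l, a k l != 0 ->
        (wt (p, q) (k1 + k2) (l1 + l2) <= wt (p, q) k l)%N /\
        (wt (p, q) (k1 + k2) (l1 + l2) = wt (p, q) k l ->
         (wt t (k1 + k2) (l1 + l2) <= wt t k l)%N)].
  move=> tpq.
  have [k1 [l1 bm]] := ex_lex_min (p, q) t b1.
  have [k2 [l2 cm]] := ex_lex_min (p, q) t c1.
  exists k1, l1, k2, l2; split=> //.
    by rewrite abc; apply: mul_series_lex_min bm cm.
  move=> k l; rewrite abc => /mul_series_neq0[i [j [ik jl bij cij]]].
  case: bm cm => _ bw bt [_ cw ct].
  have w1 := bw _ _ bij; have w2 := cw _ _ cij.
  rewrite -(wt_sub (p, q) ik jl) -(wt_sub t ik jl) !wtD; split; first lia.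
  by move=> E; apply: leq_add; [apply: bt|apply: ct] => //; lia.
(* Breaking ties by the first exponent selects the end [(0, p)] of the edge; breaking them by the
   second selects [(q, 0)]. *)
have [|k1 [l1 [k2 [l2 [bm cm /aN a12 amin]]]]] := key (1%N, 0%N).
  by rewrite /=; lia.
have [|k3 [l3 [k4 [l4 [bm' cm' /aN a34 amin']]]]] := key (0%N, 1%N).
  by rewrite /=; lia.
have [E1 E2] : (k1 + k2 = 0)%N /\ (l1 + l2 = p)%N.
  have [] := amin _ _ a0p; rewrite /wt /= => A B.
  by case: a12 => [[]|[]|]; [lia|nia|nia].
have [E3 E4] : (k3 + k4 = q)%N /\ (l3 + l4 = 0)%N.
  have [] := amin' _ _ aq0; rewrite /wt /= => A B.
  by case: a34 => [[]|[]|]; [nia|lia|nia].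
(* Both minima of [b] have the same [(p, q)]-weight. Coprimality then leaves only [l1 = 0], where
   [b] has a nonzero constant term, and [l1 = p], where [c] has one. *)
have E5 : (q * l1 = p * k3)%N.
  case: bm bm' => b11 bw _ [b33 bw' _].
  have := bw _ _ b33; have := bw' _ _ b11; rewrite /wt /=; nia.
have : (p %| l1)%N by rewrite -(Gauss_dvdr _ pq) E5 dvdn_mulr.
case: bm cm => b11 _ _ [c22 _ _].
case: (posnP l1) => [l10 _|l1p /(dvdn_leq l1p) pl]; [left|right].
  by move: b11; rewrite l10; have -> : k1 = 0%N by lia.
have k20 : k2 = 0%N by lia.
have l20 : l2 = 0%N by lia.
by rewrite k20 l20 in c22.
Qed.

End NewtonPolygon.

(** * Jacobian syzygies and freeness of the curve *)

Section Curve.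
Variable K : numFieldType.
Variables k m : nat.

Notation x := ('X_0 : {mpoly K[3]}).
Notation y := ('X_1 : {mpoly K[3]}).
Notation z := ('X_2 : {mpoly K[3]}).
Notation d1 := k.+2.
Notation e := (k + m).+3.
Notation d := (k + k + m + 4).+1.

(* [d1 = k + 2] and [m = d2 - d1], to avoid truncated subtractions. *)
Definition curve : {mpoly K[3]} :=
  x ^+ d + x ^+ d1 * y ^+ e + y ^+ (k + k + m + 4) * z.

Let eqI3 := (eqxx, erefl : (0 == 1 :> 'I_3) = false,
  erefl : (0 == 2 :> 'I_3) = false, erefl : (1 == 0 :> 'I_3) = false,
  erefl : (1 == 2 :> 'I_3) = false, erefl : (2 == 0 :> 'I_3) = false,
  erefl : (2 == 1 :> 'I_3) = false).

Lemma curve_dx : curve^`M(0) = x ^+ d.-1 *+ d + x ^+ k.+1 * y ^+ e *+ d1.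
Proof.
rewrite /curve !mderivD (mderivM _ (_ ^+ d1)) (mderivM _ _ z) !mderivXn !mderivXU !eqI3.
rewrite ?(mulr0n, mulr1n, mulr0, mul0r, mul0rn, mulr1, addr0, add0r).
by rewrite mulrnAl.
Qed.

Lemma curve_dy : curve^`M(1) =
  x ^+ d1 * y ^+ e.-1 *+ e + y ^+ (k + k + m + 3) * z *+ (k + k + m + 4).
Proof.
rewrite /curve !mderivD (mderivM _ (_ ^+ d1)) (mderivM _ _ z) !mderivXn !mderivXU !eqI3.
rewrite ?(mulr0n, mulr1n, mulr0, mul0r, mul0rn, mulr1, addr0, add0r).
rewrite mulrnAr mulrnAl.
by rewrite addnS.
Qed.

Lemma curve_dz : curve^`M(2) = y ^+ (k + k + m + 4).
Proof.
rewrite /curve !mderivD (mderivM _ (_ ^+ d1)) (mderivM _ _ z) !mderivXn !mderivXU !eqI3.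
by rewrite ?(mulr0n, mulr1n, mulr0, mul0r, mul0rn, mulr1, addr0, add0r).
Qed.

Definition syzQ := x ^+ d1 *+ e + y ^+ k.+1 * z *+ (k + k + m + 4).
(* [syzb] is [e d x^d2] divided by [1 + (d - 1) y^(d1-1) z / (e x^d1)], i.e. by
   [Q / (e x^d1)], as a power series in [y] modulo [y^d1]; the series stops after
   two terms because [2 (d1 - 1) >= d1]. *)
Definition syzb := x ^+ (k + m).+2 *+ (e * d)
                   - x ^+ m * y ^+ k.+1 * z *+ (d * d.-1).
(** The quotient of [e^2 f_x - syzb Q] by [y^d1], which is exact by the choice of [syzb]. *)
Definition syzc := x ^+ k.+1 * y ^+ m.+1 *+ (e ^ 2 * d1)
                   + x ^+ m * y ^+ k * z ^+ 2 *+ (d * d.-1 ^ 2).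

Definition syz1 : 'rV[{mpoly K[3]}]_3 :=
  \row_j (if j == 0 then 0 else if j == 1 then y ^+ d1 else - syzQ).
Definition syz2 : 'rV[{mpoly K[3]}]_3 :=
  \row_j (if j == 0 then - (y ^+ (k + m).+2 *+ e ^ 2) else if j == 1 then syzb else syzc).

Lemma AR_curve (a : 'rV_3) :
  AR curve a <-> a 0 0 * curve^`M(0) + a 0 1 * curve^`M(1) + a 0 2 * curve^`M(2) = 0.
Proof.
rewrite /AR !big_ord_recl big_ord0 addr0 addrA.
have -> : lift ord0 ord0 = 1 :> 'I_3 by apply: val_inj.
have -> : lift ord0 (lift ord0 ord0) = 2 :> 'I_3 by apply: val_inj.
by [].
Qed.

Lemma curve_dyE : curve^`M(1) = y ^+ (k + m).+2 * syzQ.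
Proof. rewrite curve_dy /syzQ !exprS !exprD; ring. Qed.

Lemma curve_dzE : curve^`M(2) = y ^+ (k + m).+2 * y ^+ d1.
Proof. rewrite curve_dz -exprD; congr (_ ^+ _); lia. Qed.

Lemma AR_syz1 : AR curve syz1.
Proof.
apply/AR_curve; rewrite !mxE /= curve_dyE curve_dzE; ring.
Qed.

Lemma AR_syz2 : AR curve syz2.
Proof.
apply/AR_curve; rewrite !mxE /= curve_dx curve_dyE curve_dzE /syzb /syzc /syzQ.
rewrite /= ?(exprS, exprD); ring.
Qed.

Lemma homog_syz1 : homog_vec d1 syz1.
Proof.
move=> i; rewrite mxE; case: ifP => _; first exact: rpred0.
case: ifP => _; first exact: dhomogXn.
rewrite rpredN rpredD ?rpredMn ?dhomogXn //.
have -> : d1 = (k.+1 + 1)%N by lia.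
by rewrite dhomogM ?dhomogXn // -[z]expr1 dhomogXn.
Qed.

Lemma homog_syz2 : homog_vec (k + m).+2 syz2.
Proof.
have z1 : z \is 1.-homog by rewrite -[z]expr1 dhomogXn.
move=> i; rewrite mxE; case: ifP => _; first by rewrite rpredN rpredMn // dhomogXn.
case: ifP => _.
  rewrite rpredB ?rpredMn ?dhomogXn //.
  have -> : (k + m).+2 = (m + k.+1 + 1)%N by lia.
  by rewrite !dhomogM ?dhomogXn.
rewrite rpredD ?rpredMn //.
  have -> : (k + m).+2 = (k.+1 + m.+1)%N by lia.
  by rewrite dhomogM ?dhomogXn.
have -> : (k + m).+2 = (m + k + 2)%N by lia.
by rewrite !dhomogM ?dhomogXn.
Qed.

Lemma row3P (a b : 'rV[{mpoly K[3]}]_3) :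
  a 0 0 = b 0 0 -> a 0 1 = b 0 1 -> a 0 2 = b 0 2 -> a = b.
Proof. by move=> H0 H1 H2; apply/rowP; exact: ord3P. Qed.

Lemma mpoly_natr_neq0 n l (p : {mpoly K[n]}) : (0 < l)%N -> p != 0 -> p *+ l != 0.
Proof.
move=> l0 p0; rewrite -scaler_nat -mul_mpolyC mulf_neq0 //.
by rewrite mpolyC_eq0 pnatr_eq0 -lt0n.
Qed.

Lemma free_curve : free_with_exponents curve d1 (k + m).+2.
Proof.
split; first lia.
exists syz1, syz2; split;
  [exact: AR_syz1|exact: homog_syz1|exact: AR_syz2|exact: homog_syz2|].
have y0 : y != 0 by exact: mpolyXU_neq0.
(* Modulo [y], [syzQ] reduces to [e x^d1] and [f_x] to [d x^(d-1)], both nonzero in characteristic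
   zero. *)
have Qz : syzQ \mPo zero_at K 1 != 0.
  rewrite /syzQ comp_mpolyD !comp_mpolyMn (comp_mpolyM _ _ z) !comp_mpolyXn.
  rewrite !comp_zero_atX !eqI3 expr0n mul0r mul0rn addr0.
  by apply: mpoly_natr_neq0 => //; rewrite expf_neq0 // mpolyXU_neq0.
have fxz : curve^`M(0) \mPo zero_at K 1 != 0.
  rewrite curve_dx comp_mpolyD !comp_mpolyMn (comp_mpolyM _ _ (y ^+ _)) !comp_mpolyXn.
  rewrite !comp_zero_atX !eqI3 expr0n mulr0 mul0rn addr0.
  by apply: mpoly_natr_neq0 => //; rewrite expf_neq0 // mpolyXU_neq0.
move=> a /AR_curve; rewrite curve_dyE curve_dzE => Ha.
have [t a0] : exists t, a 0 0 = y ^+ (k + m).+2 * t.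
  apply: (dvd_mpolyXn_mul (r := - (a 0 1 * syzQ + a 0 2 * y ^+ d1)) fxz).
  apply/eqP; rewrite -subr_eq0 -[X in _ == X]Ha; apply/eqP; ring.
(* The first entry of [syz2] is [- e^2 y^d2] and that of [syz1] is zero, which forces this
   coefficient. *)
pose c2 := - ((e ^ 2)%:R^-1 *: t).
have e0 : (e ^ 2)%:R != 0 :> K by rewrite pnatr_eq0 -lt0n expn_gt0.
have c2E : t + c2 *+ e ^ 2 = 0.
  by rewrite /c2 mulNrn -scaler_nat scalerA divff // scale1r subrr.
(* Subtracting [c2 *: syz2] kills the first entry, and the common factor [y^d2] of [f_y] and [f_z]
   cancels. *)
have Ha' : (a 0 1 - c2 * syzb) * syzQ + (a 0 2 - c2 * syzc) * y ^+ d1 = 0.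
  have := AR_syz2 => /AR_curve; rewrite !mxE /= curve_dyE curve_dzE => Hs.
  apply: (mulfI (expf_neq0 (k + m).+2 y0)); rewrite mulr0.
  have -> : y ^+ (k + m).+2 * ((a 0 1 - c2 * syzb) * syzQ + (a 0 2 - c2 * syzc) * y ^+ d1)
   = - (y ^+ (k + m).+2 * (t + c2 *+ e ^ 2) * curve^`M(0)).
    apply/eqP; rewrite -subr_eq0; apply/eqP.
    have := congr2 (fun u v => u - c2 * v) Ha Hs; cbv beta.
    rewrite [X in _ = _ - X]mulr0 subr0 => <-; rewrite a0; ring.
  by rewrite c2E mulr0 mul0r oppr0.
have [s a1] : exists s, a 0 1 - c2 * syzb = y ^+ d1 * s.
  apply: (dvd_mpolyXn_mul (r := - (a 0 2 - c2 * syzc)) Qz).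
  by apply/eqP; rewrite mulrN -addr_eq0 [y ^+ _ * _]mulrC Ha'.
have a2 : a 0 2 - c2 * syzc = - (s * syzQ).
  apply: (mulfI (expf_neq0 d1 y0)); apply/eqP; rewrite -subr_eq0; apply/eqP.
  rewrite -[RHS]Ha' a1; ring.
exists (s, c2); split.
  apply: row3P; rewrite !mxE /=.
  - rewrite mulr0 add0r a0; apply/eqP; rewrite -subr_eq0; apply/eqP.
    transitivity (y ^+ (k + m).+2 * (t + c2 *+ e ^ 2)); last by rewrite c2E mulr0.
    ring.
  - by rewrite mulrC -a1 subrK.
  - by rewrite mulrN -a2 subrK.
(* Uniqueness: the first entries determine the coefficient of [syz2], then the second entries that
   of [syz1]. *)
move=> [s' c'] /= E.
have c'E : c2 = c'.
  have := congr1 (fun v : 'rV_3 => v 0 0) E; rewrite !mxE /= mulr0 add0r a0.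
  have -> : t = - (c2 *+ e ^ 2) by apply/eqP; rewrite -addr_eq0 c2E.
  rewrite [c' * _]mulrC !mulNr mulrN => /oppr_inj.
  rewrite mulrnAl -mulrnAr => /(mulfI (expf_neq0 (k + m).+2 y0)).
  move/eqP; rewrite -subr_eq0 -mulrnBl => E0; apply/eqP; rewrite -subr_eq0.
  by apply: contraLR E0; apply: mpoly_natr_neq0; rewrite expn_gt0.
rewrite -{c'}c'E in E *; congr (_, _).
have := congr1 (fun v : 'rV_3 => v 0 1) E; rewrite !mxE /= => E1.
by apply: (mulfI (expf_neq0 d1 y0)); rewrite -a1 E1 addrK mulrC.
Qed.

(** * Irreducibility and rational parametrization *)

Lemma irreducible_curve : irreducible_mpoly curve.
Proof.
(* The curve has degree one in [z] with leading coefficient [y^(d-1)]; modulo [y] the remaining part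
   is [x^d]. *)
apply: (@irreducible_mpolyXn_mulX_add _ _ 2 1 (k + k + m + 3)
  (x ^+ d + x ^+ d1 * y ^+ e)).
- by [].
- rewrite comp_mpolyD (comp_mpolyM _ _ (y ^+ _)) !comp_mpolyXn.
  by rewrite !comp_zero_atX !eqI3.
- rewrite comp_mpolyD (comp_mpolyM _ _ (y ^+ _)) !comp_mpolyXn.
  rewrite !comp_zero_atX !eqI3 [0 ^+ _]expr0n mulr0 addr0.
  by rewrite expf_neq0 // mpolyXU_neq0.
- by rewrite /curve -!addnS.
Qed.

Notation s := ('X_0 : {mpoly K[2]}).
Notation t := ('X_1 : {mpoly K[2]}).

(** The point [(s : t : z)] with [z] solved from the equation of the curve, after multiplication by
    the denominator [t^(d-1)]. *)
Definition param : 3.-tuple {mpoly K[2]} :=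
  [tuple s * t ^+ d.-1; t ^+ d; - (s ^+ d + s ^+ d1 * t ^+ e)].

Lemma comp_curve n (T : 3.-tuple {mpoly K[n]}) : curve \mPo T =
  tnth T 0 ^+ d + tnth T 0 ^+ d1 * tnth T 1 ^+ e + tnth T 1 ^+ d.-1 * tnth T 2.
Proof.
rewrite /curve !comp_mpolyD (comp_mpolyM _ _ (y ^+ _)) (comp_mpolyM _ _ z).
by rewrite !comp_mpolyXn !comp_mpolyXU -!tnth_nth.
Qed.

Lemma comp_curve_param : curve \mPo param = 0.
Proof.
rewrite comp_curve !(tnth_nth 0) [nth _ _ _]/= [nth _ _ 1]/= [nth _ _ 2]/= [d.-1]/=.
rewrite !exprMn -!exprM mulrN; apply/eqP; rewrite subr_eq0; apply/eqP.
move: (s ^+ d) (s ^+ d1) => sd sd1; rewrite -mulrA -exprD mulrDr.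
rewrite [RHS]addrC [_ * (sd1 * _)]mulrCA -exprD addrC [in RHS]mulrC.
by congr (_ * _ ^+ _ + _ * _ ^+ _); rewrite /=; lia.
Qed.

(** This shows that the image of [param] lies on the curve, and also serves to detect forms outside
    the ideal of the curve. *)
Lemma principal_ideal_param g : principal_ideal curve g -> g \mPo param = 0.
Proof. by case=> h ->; rewrite comp_mpolyM comp_curve_param mulr0. Qed.

(** The inverse of [param] is the projection from [(0 : 0 : 1)]. Both composites multiply the
    coordinates by the [(d-1)]-st power of the second one, on the curve only modulo its equation. *)
Lemma curve_rational : rational_curve curve.
Proof.
have yF : 'X_1 \mPo param != 0.
  by rewrite comp_mpolyXU expf_neq0 // mpolyXU_neq0.
have s1 (i : 'I_2) : ('X_i : {mpoly K[2]}) \is 1.-homog by rewrite -['X_i]expr1 dhomogXn.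
exists param, [tuple x; y]; split.
- split.
  + exists d; apply: ord3P; rewrite (tnth_nth 0) [nth _ _ _]/=.
    * by rewrite -[d]add1n dhomogM ?dhomogXn.
    * exact: dhomogXn.
    * rewrite rpredN rpredD ?dhomogXn //.
      have -> : d = (d1 + e)%N by lia.
      by rewrite dhomogM ?dhomogXn.
  + by exists 1 => /eqP; rewrite expf_eq0 /= (negPf (mpolyXU_neq0 _ _)).
  + exact: principal_ideal_param.
- split.
  + exists 1%N; apply: ord2P; rewrite (tnth_nth 0) [nth _ _ _]/=.
      by rewrite -['X_0]expr1 dhomogXn.
    by rewrite -['X_1]expr1 dhomogXn.
  + exists 1 => /principal_ideal_param/eqP; exact/negP.
  + by move=> g ->; exists 0; rewrite comp_mpoly0 mul0r.
- have E0 : tnth (comp_tuple [tuple x; y] param) 0 = s * t ^+ d.-1.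
    by rewrite tnth_mktuple (tnth_nth 0) comp_mpolyXU.
  have E1 : tnth (comp_tuple [tuple x; y] param) 1 = t ^+ d.
    by rewrite tnth_mktuple (tnth_nth 0) comp_mpolyXU.
  split.
    exists 1; rewrite E1; apply/eqP; by rewrite expf_neq0 // mpolyXU_neq0.
  rewrite /zero_ideal.
  apply: ord2P; apply: ord2P; rewrite ?E0 ?E1 ?subrr //.
    by rewrite mulrAC -mulrA -exprS mulrC subrr.
  by rewrite mulrAC -mulrA -exprS mulrC subrr.
have E0 : tnth (comp_tuple param [tuple x; y]) 0 = x * y ^+ d.-1.
  rewrite tnth_mktuple (tnth_nth 0) [nth _ _ _]/=.
  by rewrite comp_mpolyM comp_mpolyXn !comp_mpolyXU.
have E1 : tnth (comp_tuple param [tuple x; y]) 1 = y ^+ d.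
  by rewrite tnth_mktuple (tnth_nth 0) [nth _ _ _]/= comp_mpolyXn !comp_mpolyXU.
have E2 : tnth (comp_tuple param [tuple x; y]) 2 = - (x ^+ d + x ^+ d1 * y ^+ e).
  rewrite tnth_mktuple (tnth_nth 0) [nth _ _ _]/= comp_mpolyN comp_mpolyD.
  by rewrite (comp_mpolyM _ _ (t ^+ _)) !comp_mpolyXn !comp_mpolyXU.
split.
  exists 1; rewrite E1 => /principal_ideal_param/eqP.
  by rewrite comp_mpolyXn expf_eq0 (negPf yF) andbF.
have I0 g : g = 0 -> principal_ideal curve g.
  by move=> ->; exists 0; rewrite mul0r.
have IN g h : principal_ideal curve g -> h = - g -> principal_ideal curve h.
  by case=> q -> ->; exists (- q); rewrite mulNr.
(* Up to sign, the minors to be tested are zero, [x * curve] and [y * curve]. *)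
have I01 : x * y ^+ d.-1 * y - y ^+ d * x = 0 by rewrite -mulrA -exprSr mulrC subrr.
have I02 : principal_ideal curve (x * y ^+ d.-1 * z + (x ^+ d + x ^+ d1 * y ^+ e) * x).
  by exists x; rewrite /curve [d.-1]/=; ring.
have I12 : principal_ideal curve (y ^+ d * z + (x ^+ d + x ^+ d1 * y ^+ e) * y).
  by exists y; rewrite /curve exprS; ring.
apply: ord3P; apply: ord3P;
  rewrite ?E0 ?E1 ?E2 ?mulNr ?opprK ?subrr ?addNr; try exact: I0.
- exact: I02.
- by apply: I0; rewrite -opprB I01 oppr0.
- exact: I12.
- by apply: IN I02 _; rewrite -opprD addrC.
- by apply: IN I12 _; rewrite -opprD addrC.
Qed.

(** * The singular locus and the local equation at the cusp *)

Lemma zero_curve (Q : 'rV[K]_3) : curve.@[Q 0] =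
  Q 0 0 ^+ d + Q 0 0 ^+ d1 * Q 0 1 ^+ e + Q 0 1 ^+ d.-1 * Q 0 2.
Proof.
rewrite /curve !mevalD (mevalM _ _ (y ^+ _)) (mevalM _ _ z).
by rewrite !rmorphXn /= !mevalXU.
Qed.

Definition cusp : 'rV[K]_3 := delta_mx 0 2.

Lemma singular_cusp : singular_point curve cusp.
Proof.
have c0 : cusp 0 0 = 0 by rewrite mxE.
have c1 : cusp 0 1 = 0 by rewrite mxE.
split.
- by apply/eqP => /rowP/(_ 2)/eqP; rewrite !mxE; exact/negP/oner_neq0.
- by rewrite zero_curve c0 c1 [d.-1]/= addnS !exprS !mul0r !addr0.
have mX i n : ('X_i ^+ n).@[cusp 0] = cusp 0 i ^+ n by rewrite rmorphXn /= mevalXU.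
apply: ord3P; rewrite ?(curve_dx, curve_dy, curve_dz).
- rewrite mevalD (mevalMn _ d1) mevalMn (mevalM _ _ (y ^+ _)) !mX c0 c1.
  by rewrite [d.-1]/= addnS !exprS !mul0r !mul0rn addr0.
- rewrite mevalD (mevalMn _ e) mevalMn (mevalM _ _ (y ^+ _)) (mevalM _ _ z) !mX c0 c1.
  by rewrite addnS !exprS !mul0r !mul0rn addr0.
- by rewrite mX c1 addnS exprS mul0r.
Qed.

(** The derivative [f_z = y^(d-1)] forces [y = 0], and then the equation reduces to [x^d = 0]. *)
Lemma singular_point_curve (Q : 'rV[K]_3) :
  singular_point curve Q -> exists c, Q = c *: cusp.
Proof.
case=> _ Q0 dQ; exists (Q 0 2).
have Q1 : Q 0 1 = 0.
  have := dQ 2; rewrite curve_dz rmorphXn /= mevalXU => /eqP.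
  by rewrite expf_eq0 => /andP[_ /eqP].
have Q00 : Q 0 0 = 0.
  have := Q0; rewrite zero_curve Q1 [d.-1]/= addnS ![0 ^+ _]expr0n mulr0 mul0r !addr0.
  by move=> /eqP; rewrite expf_eq0 => /andP[_ /eqP].
apply/rowP; apply: ord3P; rewrite !mxE ?Q1 ?Q00 ?mulr0 //.
by rewrite mulr1.
Qed.

Definition local_curve : {mpoly K[2]} := s ^+ d + s ^+ d1 * t ^+ e + t ^+ d.-1.

(** Only the chart [z = 1] contains the cusp, which is already its origin. *)
Lemma local_equation_curve i : cusp 0 i != 0 ->
  local_equation curve cusp i = local_curve.
Proof.
move: i; apply: ord3P => [||_]; try by rewrite mxE /= eqxx.
have u0 : unlift (2 : 'I_3) 0 = Some (0 : 'I_2).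
  rewrite (_ : 0 = lift (2 : 'I_3) (0 : 'I_2)) ?liftK //; exact: val_inj.
have u1 : unlift (2 : 'I_3) 1 = Some (1 : 'I_2).
  rewrite (_ : 1 = lift (2 : 'I_3) (1 : 'I_2)) ?liftK //; exact: val_inj.
have u2 : unlift (2 : 'I_3) 2 = None by rewrite unlift_none.
rewrite /local_equation comp_curve !tnth_mktuple u0 u1 u2 mulr1 /local_curve.
by rewrite !mxE !mul0r !mpolyC0 !addr0.
Qed.

Lemma taylor2D (p q : {mpoly K[2]}) a b :
  taylor2 (p + q) a b = taylor2 p a b + taylor2 q a b.
Proof. exact: mcoeffD. Qed.

Lemma taylor2_monomial i j a b :
  taylor2 (s ^+ i * t ^+ j) a b = ((a == i) && (b == j))%:R.
Proof.
rewrite /taylor2 !mpolyXn -mpolyXD mcoeffX; congr (nat_of_bool _)%:R.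
apply/eqP/andP => [/mnmP E|[/eqP-> /eqP->]].
  have := E 0; have := E 1; rewrite !mnmE /=.
  by rewrite !mulmnE !mnm1E /= !mul0n !mul1n addn0 add0n => -> ->; rewrite !eqxx.
apply/mnmP; apply: ord2P; rewrite !mnmE !mulmnE !mnm1E /= !mul0n !mul1n //.
by rewrite addn0.
Qed.

Lemma taylor2_local_curve a b : taylor2 local_curve a b =
  ((a == d) && (b == 0%N))%:R + ((a == d1) && (b == e))%:R
  + ((a == 0%N) && (b == d.-1))%:R.
Proof.
rewrite -!taylor2_monomial -!taylor2D /local_curve.
by rewrite [t ^+ 0]expr0 mulr1 [s ^+ 0]expr0 mul1r.
Qed.

Lemma convergent_taylor2 (g : {mpoly K[2]}) : convergent (taylor2 g).
Proof.
exists (\sum_(n <- msupp g) `|g@_n|), 1; split; first exact: ltr01.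
move=> a b; rewrite expr1n mulr1 /taylor2; set n := [multinom _ | _ < _].
have [ng|/memN_msupp_eq0 ->] := boolP (n \in msupp g).
  rewrite (bigD1_seq n) //= ?msupp_uniq // lerDl.
  exact: sumr_ge0.
by rewrite normr0 sumr_ge0.
Qed.

Lemma irreducible_germ_local_curve : irreducible_germ (taylor2 local_curve).
Proof.
apply: (@irreducible_germ_newton _ d.-1 d) => //.
- by rewrite addnS.
- exact: coprimenS.
- exact: convergent_taylor2.
- by rewrite taylor2_local_curve /= !eqxx ?andbF /= ?mulr0n ?mulr1n !add0r oner_neq0.
- by rewrite taylor2_local_curve /= !eqxx ?andbF /= ?mulr0n ?mulr1n !addr0 oner_neq0.
move=> a b; rewrite taylor2_local_curve.
have [/andP[/eqP-> /eqP->] _|_] := boolP ((a == d) && (b == 0%N)).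
  by constructor 2.
have [/andP[/eqP-> /eqP->] _|_] := boolP ((a == d1) && (b == e)).
  (* Since [d1 + e = d], the point [(d1, e)] has weight [d (d-1) + e], strictly above the edge. *)
  by constructor 3; rewrite /=; nia.
have [/andP[/eqP-> /eqP->] _|_] := boolP ((a == 0%N) && (b == d.-1)).
  by constructor 1.
by rewrite !addr0 eqxx.
Qed.

Lemma local_curve_eval (w : 'I_2 -> K) : local_curve.@[w] =
  w 0 ^+ d + w 0 ^+ d1 * w 1 ^+ e + w 1 ^+ d.-1.
Proof.
by rewrite /local_curve !mevalD (mevalM _ _ (t ^+ _)) !rmorphXn /= !mevalXU.
Qed.

End Curve.

(** * The rescaling factor and its effect on the equations *)

Section Rescaling.
Variable K : numClosedFieldType.
Implicit Types u v c : K.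

(* [qden u v] is twice the maximum of [|u|^2] and [4 |v|^2], so that [quo u v]
   is [v / u] where [2 |v| <= |u|], has norm at most [1/2] and is continuous
   away from the origin. *)
Definition qden u v := `|u| ^+ 2 + 4 * `|v| ^+ 2 + `| `|u| ^+ 2 - 4 * `|v| ^+ 2 |.
Definition quo u v := 2 * v * u^* / qden u v.

Lemma qden_ge u v : `|u| ^+ 2 + 4 * `|v| ^+ 2 <= qden u v.
Proof. by rewrite /qden lerDl. Qed.

Lemma qden_gt0 u v : (u != 0) || (v != 0) -> 0 < qden u v.
Proof.
move=> uv; apply: lt_le_trans (qden_ge u v).
case/orP: uv => ?; first by rewrite ltr_wpDr ?exprn_gt0 ?normr_gt0 // mulr_ge0 ?exprn_ge0.
by rewrite ltr_wpDl ?exprn_ge0 // mulr_gt0 // exprn_gt0 ?normr_gt0.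
Qed.

Lemma qden_ge0 u v : 0 <= qden u v.
Proof. by apply: le_trans (qden_ge u v); rewrite addr_ge0 ?mulr_ge0 ?exprn_ge0. Qed.

(** By the inequality of means, [4 |u| |v| <= |u|^2 + 4 |v|^2], which is at most [qden u v]. *)
Lemma norm_quo_le u v : `|quo u v| <= 2^-1.
Proof.
have Duv : 4 * (`|v| * `|u|) <= qden u v.
  apply: le_trans (qden_ge u v); rewrite -subr_ge0.
  have -> : `|u| ^+ 2 + 4 * `|v| ^+ 2 - 4 * (`|v| * `|u|) =
      (`|u| - 2 * `|v|) ^+ 2 by ring.
  by rewrite real_exprn_even_ge0 // rpredB ?rpredM ?normr_real ?realn.
(* At the origin the denominator vanishes and [quo] takes the default value 0. *)
have [D0|D0] := eqVneq (qden u v) 0.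
  by rewrite /quo D0 invr0 mulr0 normr0 invr_ge0.
have Dp : 0 < qden u v by rewrite lt0r D0 qden_ge0.
rewrite /quo !normrM normfV norm_conjC (gtr0_norm Dp) ger0_norm // ler_pdivrMr //.
rewrite -(ler_pM2l (x := 2)) // [leRHS]mulrA mulfV ?mul1r ?pnatr_eq0 //.
by apply: le_trans Duv; rewrite le_eqVlt; apply/orP; left; apply/eqP; ring.
Qed.

(** Numerator and denominator both scale by [|c|^2]. Away from the origin [quo] thus depends only on
    [(u : v)], which makes the rescaling invertible. *)
Lemma quoZ c u v : c != 0 -> quo (c * u) (c * v) = quo u v.
Proof.
move=> c0; have D : qden (c * u) (c * v) = `|c| ^+ 2 * qden u v.
  rewrite /qden !normrM !exprMn [4 * (`|c| ^+ 2 * _)]mulrCA -mulrBr.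
  rewrite normrM normrX normr_id -!mulrDr; ring.
have c2 : `|c| ^+ 2 != 0 by rewrite expf_neq0 // normr_eq0.
rewrite /quo D rmorphM /= invfM.
have -> : 2 * (c * v) * (c^* * u^*) = `|c| ^+ 2 * (2 * v * u^*) by rewrite normCK; ring.
by rewrite mulrACA divff // mul1r.
Qed.

Lemma quoE u v : u != 0 -> 2 * `|v| <= `|u| -> quo u v = v / u.
Proof.
move=> u0 vu; have uv0 : 0 <= `|u| ^+ 2 - 4 * `|v| ^+ 2.
  have -> : 4 * `|v| ^+ 2 = (2 * `|v|) ^+ 2 by ring.
  by rewrite subr_ge0 ler_sqr ?nnegrE ?mulr_ge0.
rewrite /quo /qden (ger0_norm uv0).
have -> : `|u| ^+ 2 + 4 * `|v| ^+ 2 + (`|u| ^+ 2 - 4 * `|v| ^+ 2) = 2 * `|u| ^+ 2 by ring.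
have uc : u^* != 0 by rewrite fmorph_eq0.
rewrite normCK; field; by rewrite u0 uc.
Qed.

(** The factor [1 + (v/u)^e], extended from the region [2 |v| <= |u|] so as to be continuous away
    from the origin and, for [e > 0], of norm between [1/2] and [2]. *)
Definition rescale e u v := 1 + quo u v ^+ e.

Lemma norm_quoX_le e u v : (0 < e)%N -> `|quo u v ^+ e| <= 2^-1.
Proof.
move=> e0; rewrite normrX -[leRHS]expr1.
apply: (le_trans (y := 2^-1 ^+ e)).
  by rewrite lerXn2r ?nnegrE ?invr_ge0 // norm_quo_le.
by rewrite ler_wiXn2l // ?invr_ge0 // invf_le1 // ler1n.
Qed.

Lemma norm_rescale_ge e u v : (0 < e)%N -> 2^-1 <= `|rescale e u v|.
Proof.
move=> e0; rewrite /rescale -[X in _ + X]opprK.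
apply: le_trans (lerB_dist _ _); rewrite normr1 normrN lerBrDr -lerBrDl.
apply: le_trans (norm_quoX_le u v e0) _; rewrite le_eqVlt; apply/orP; left.
by apply/eqP; field.
Qed.

Lemma norm_rescale_le e u v : (0 < e)%N -> `|rescale e u v| <= 2.
Proof.
move=> e0; apply: le_trans (ler_normD _ _) _; rewrite normr1.
have := lerD (lexx 1) (norm_quoX_le u v e0) => /le_trans; apply.
by rewrite -[leRHS]/(1 + 1) lerD2l invf_le1 // ler1n.
Qed.

Lemma rescale_neq0 e u v : (0 < e)%N -> rescale e u v != 0.
Proof.
move=> e0; rewrite -normr_gt0; apply: lt_le_trans (norm_rescale_ge u v e0).
by rewrite invr_gt0.
Qed.

Lemma rescaleZ e c u v : c != 0 -> rescale e (c * u) (c * v) = rescale e u v.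
Proof. by move=> c0; rewrite /rescale quoZ. Qed.

(** If [a] were nonzero, dividing by [a ^+ n] would give [1 <= D * a]. *)
Lemma eq0_of_expr_le (a D : K) n : 0 <= a ->
  a ^+ n <= D * a ^+ n.+1 -> D * a < 1 -> a = 0.
Proof.
move=> a0 aD Da; apply/eqP; apply: contraTT aD => a1.
have an : 0 < a ^+ n by rewrite exprn_gt0 // lt0r a1.
rewrite exprS mulrA -[X in X <= _]mul1r ler_pM2r //.
by apply/negP => /le_lt_trans/(_ Da); rewrite ltxx.
Qed.

(* Where [2 |v| <= |u|] the curve is [v^p = - rescale u v * u^(p+1)]. *)
Lemma rescale_curve p e l u v : (0 < p)%N -> (0 < e)%N -> (l + e = p.+1)%N ->
  2 * `|v| <= `|u| ->
  (u ^+ p.+1 + u ^+ l * v ^+ e + v ^+ p = 0) <->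
  ((- (rescale e u v * v)) ^+ p = (- (rescale e u v * u)) ^+ p.+1).
Proof.
move=> p0 e0 lep vu.
have [u0|u0] := eqVneq u 0.
  have v0 : v = 0.
    apply/eqP; rewrite -normr_eq0 eq_le normr_ge0 andbT.
    by move: vu; rewrite u0 normr0 pmulr_rle0.
  have z n : (0 < n)%N -> 0 ^+ n = 0 :> K by case: n => // n _; rewrite exprS mul0r.
  by rewrite u0 v0 !mulr0 oppr0 (z p.+1) // (z e) // (z p) // mulr0 !addr0.
have s0 := rescale_neq0 u v e0; set s := rescale e u v in s0 *.
have su : s * u ^+ p.+1 = u ^+ p.+1 + u ^+ l * v ^+ e.
  rewrite /s /rescale quoE // mulrDl mul1r; congr (_ + _).
  by rewrite expr_div_n -lep exprD; field; rewrite expf_neq0.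
(* The right side has one more factor [- s]: after cancelling [(- s)^p] the equation is
   [v^p = - s u^(p+1)], whatever the parity of [p]. *)
rewrite -su -!mulNr ![(- s * _) ^+ _]exprMn [(- s) ^+ p.+1]exprSr -[_ * - s * _]mulrA.
split=> [E|]; first by congr (_ * _); rewrite mulNr; apply/eqP; rewrite -addr_eq0 addrC E.
move/(mulfI (expf_neq0 p (_ : - s != 0))) => ->; last by rewrite oppr_eq0.
by rewrite mulNr subrr.
Qed.

(** If [|u| < 2 |v|], the two other terms are each at most [(2 |v|)^(p+1)], so
    [|v|^p <= 2^(p+2) |v|^(p+1)]; for such small [v] this forces [v = 0], a contradiction. *)
Lemma curve_near0 p e l u v : (l + e = p.+1)%N -> `|v| < 2^-1 ^+ p.+2 ->
  u ^+ p.+1 + u ^+ l * v ^+ e + v ^+ p = 0 -> 2 * `|v| <= `|u|.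
Proof.
move=> lep v1 E.
have [//|uv] := real_leP (rpredM (realn _ 2) (normr_real v)) (normr_real u).
have v0 : `|v| = 0.
  apply: (eq0_of_expr_le (D := 2 ^+ p.+2) (n := p)) => //.
    have -> : `|v| ^+ p = `|u ^+ p.+1 + u ^+ l * v ^+ e|.
      rewrite -normrX -[RHS]normrN; congr (`| _ |).
      by apply/eqP; rewrite -addr_eq0 addrC E.
    apply: le_trans (ler_normD _ _) _; rewrite normrM !normrX.
    have -> : 2 ^+ p.+2 * `|v| ^+ p.+1 = (2 * `|v|) ^+ p.+1 + (2 * `|v|) ^+ p.+1.
      by rewrite !exprMn exprS; ring.
    apply: lerD; first by rewrite lerXn2r ?nnegrE ?mulr_ge0 // ltW.
    rewrite -lep exprD ler_pM ?exprn_ge0 ?lerXn2r ?nnegrE ?mulr_ge0 // ?(ltW uv) //.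
    by rewrite -[leLHS]mul1r ler_wpM2r // ler1n.
  by rewrite -ltr_pdivlMl ?exprn_gt0 // mulr1 -exprVn.
by move: uv; rewrite v0 mulr0 normr_lt0.
Qed.

(** Same estimate with a single term, whence the weaker bound on [v]. *)
Lemma model_near0 p u v : `|v| < 2^-1 ^+ p.+1 -> v ^+ p = u ^+ p.+1 -> 2 * `|v| <= `|u|.
Proof.
move=> v1 E.
have [//|uv] := real_leP (rpredM (realn _ 2) (normr_real v)) (normr_real u).
have v0 : `|v| = 0.
  apply: (eq0_of_expr_le (D := 2 ^+ p.+1) (n := p)) => //.
    rewrite -normrX E normrX -exprMn lerXn2r ?nnegrE ?mulr_ge0 //; exact: ltW.
  by rewrite -ltr_pdivlMl ?exprn_gt0 // mulr1 -exprVn.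
by move: uv; rewrite v0 mulr0 normr_lt0.
Qed.

End Rescaling.

(** * Continuity of the rescaling, and the homeomorphism of germs *)

Lemma rV_continuous (S T : topologicalType) n (f : S -> 'rV[T]_n) :
  (forall j, continuous (fun w => f w 0 j)) -> continuous f.
Proof.
move=> fc w B [P Pf PB]; apply: (filterS (P := [set v | forall j, P 0 j (f v 0 j)])).
  by move=> v Pv; apply: PB => i j; rewrite ord1.
by apply: filter_forall => j; apply: fc; exact: Pf.
Qed.

Section Homeo.
Variable K : numClosedFieldType.
Notation C := (K^o).
Implicit Types w : 'rV[C]_2.

Lemma conjC_continuous : continuous (fun z : C => z^* : C).
Proof.
move=> z; have Fz := @nbhs_filter C z.
apply/(@cvgrPdist_lt K C C (nbhs z) Fz (fun z : C => z^* : C) (z^*)) => eps eps0.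
have : \forall t \near z, `|z - t| < eps.
  by apply: (@cvgr_dist_lt K C _ (nbhs z) Fz id z _ _ eps0); exact: cvg_id.
by apply: filterS => t; rewrite -rmorphB norm_conjC.
Qed.

Section ContinuousAt.
Variables (T : topologicalType) (a : T) (f g : T -> C).
Hypotheses (fc : {for a, continuous f}) (gc : {for a, continuous g}).
Lemma for_cst (c : C) : {for a, continuous (fun _ : T => c)}.
Proof. exact: cst_continuous. Qed.
Lemma for_add : {for a, continuous (fun b => f b + g b : C)}.
Proof. exact: (@cvgD K C T (nbhs a) _ f g _ _ fc gc). Qed.
Lemma for_opp : {for a, continuous (fun b => - f b : C)}.
Proof. exact: (@cvgN K C T (nbhs a) _ f _ fc). Qed.
Lemma for_mul : {for a, continuous (fun b => f b * g b : C)}.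
Proof. exact: (@cvgM K T (nbhs a) _ f g _ _ fc gc). Qed.
Lemma for_inv : f a != 0 -> {for a, continuous (fun b => (f b)^-1 : C)}.
Proof. by move=> fa; exact: (@cvgV K T (nbhs a) _ f _ fa fc). Qed.
Lemma for_norm : {for a, continuous (fun b => `|f b| : C)}.
Proof. exact: (continuous_comp fc (@norm_continuous K C _)). Qed.
End ContinuousAt.

Lemma for_exp (T : topologicalType) (f : T -> C) n a :
  {for a, continuous f} -> {for a, continuous (fun b => f b ^+ n : C)}.
Proof.
move=> fc; elim: n => [|n IHn]; first exact: for_cst.
rewrite (_ : (fun b => f b ^+ n.+1 : C) = (fun b => f b * f b ^+ n : C)).
  exact: for_mul.
by apply/funext => b; rewrite exprS.
Qed.

Lemma rescale_continuous e w : w != 0 ->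
  {for w, continuous (fun w => rescale e (w 0 0) (w 0 1) : C)}.
Proof.
move=> w0.
have c0 : {for w, continuous (fun w => w 0 0 : C)} by exact: coord_continuous.
have c1 : {for w, continuous (fun w => w 0 1 : C)} by exact: coord_continuous.
have n0 : {for w, continuous (fun w => `|w 0 0 : C| ^+ 2 : C)}.
  by apply: for_exp; exact: for_norm.
have n1 : {for w, continuous (fun w => 4 * `|w 0 1 : C| ^+ 2 : C)}.
  by apply: for_mul; [exact: for_cst|apply: for_exp; exact: for_norm].
apply: for_add; first exact: for_cst.
apply: for_exp; apply: for_mul.
  apply: for_mul; first by apply: for_mul => //; exact: for_cst.
  exact: (continuous_comp c0 (@conjC_continuous _)).
apply: for_inv.
  apply: for_add; first exact: for_add.
  by apply: for_norm; apply: for_add => //; exact: for_opp.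
suff : 0 < qden (w 0 0 : K) (w 0 1) by rewrite lt0r => /andP[].
apply: qden_gt0; apply: contraNT w0.
rewrite negb_or !negbK => /andP[/eqP w00 /eqP w01].
by apply/eqP/rowP; apply: ord2P; rewrite mxE.
Qed.

(** At the origin [sg] may be discontinuous, but being bounded its product with a coordinate tends
    to 0. *)
Lemma scale_continuous (sg : 'rV[C]_2 -> C) (M : K) j :
  (forall w, `|sg w| <= M) -> (forall w, w != 0 -> {for w, continuous sg}) ->
  continuous (fun w => sg w * w 0 j : C).
Proof.
move=> sgM sgc w; have [->|w0] := eqVneq w 0; last first.
  by apply: for_mul; [exact: sgc|exact: coord_continuous].
(* The bound [M] may be 0, so [M + 1] is used as a divisor. *)
have M1 : 0 < M + 1 by rewrite ltr_wpDl // (le_trans (normr_ge0 _) (sgM 0)).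
have F0 := @nbhs_filter 'rV[C]_2 0.
rewrite /continuous_at mxE mulr0.
apply/(@cvgrPdist_lt K C _ (nbhs (0 : 'rV[C]_2)) F0 (fun w => sg w * w 0 j : C) 0).
move=> eps eps0.
have epsM : 0 < eps / (M + 1) by rewrite divr_gt0.
have := @cvgr_dist_lt K C _ (nbhs (0 : 'rV[C]_2)) F0 (fun t => t 0 j) _
  (@coord_continuous K 1 2 0 j 0) _ epsM.
apply: filterS => t; rewrite mxE !sub0r !normrN normrM => tj.
apply: (le_lt_trans (y := (M + 1) * `|t 0 j : C|)).
  by rewrite ler_wpM2r // (le_trans (sgM t)) // lerDl.
by rewrite mulrC -ltr_pdivlMr.
Qed.

Lemma scale_opp_continuous (sg : 'rV[C]_2 -> C) (M : K) j :
  (forall w, `|sg w| <= M) -> (forall w, w != 0 -> {for w, continuous sg}) ->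
  continuous (fun w => - (sg w * w 0 j) : C).
Proof.
move=> sgM sgc w.
exact: (@for_opp _ w (fun w => sg w * w 0 j) (@scale_continuous _ _ j sgM sgc w)).
Qed.

Variable e : nat.
Hypothesis e0 : (0 < e)%N.

(** The sign absorbs that of [v^p = - s u^(p+1)], and the coordinates are swapped because the model
    has its smaller exponent on the first one. *)
Definition straighten w : 'rV[C]_2 :=
  \row_j (- (rescale e (w 0 0) (w 0 1) * w 0 (rev_ord j))).
(** The factor is invariant under common scaling, so it can be recovered from the image by reading
    the coordinates in swapped order. *)
Definition unstraighten w : 'rV[C]_2 :=
  \row_j (- ((rescale e (w 0 1) (w 0 0))^-1 * w 0 (rev_ord j))).

Let rev0 : rev_ord (0 : 'I_2) = 1. Proof. exact: val_inj. Qed.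
Let rev1 : rev_ord (1 : 'I_2) = 0. Proof. exact: val_inj. Qed.

Lemma straightenK : cancel straighten unstraighten.
Proof.
move=> w; have s0 := rescale_neq0 (w 0 0) (w 0 1) e0.
apply/rowP => j; rewrite !mxE rev0 rev1 rev_ordK -!mulNr rescaleZ ?oppr_eq0 //.
by rewrite mulrA mulrNN mulVf // mul1r.
Qed.

Lemma unstraightenK : cancel unstraighten straighten.
Proof.
move=> w; have s0 := rescale_neq0 (w 0 1) (w 0 0) e0.
apply/rowP => j; rewrite !mxE rev0 rev1 rev_ordK -!mulNr rescaleZ ?oppr_eq0 ?invr_eq0 //.
by rewrite mulrA mulrNN mulfV // mul1r.
Qed.

Lemma straighten_continuous : continuous straighten.
Proof.
apply: rV_continuous => j.
have -> : (fun w => straighten w 0 j) =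
    (fun w => - (rescale e (w 0 0) (w 0 1) * w 0 (rev_ord j)) : C).
  by apply/funext => w; rewrite mxE.
apply: (scale_opp_continuous (M := 2)); first by move=> w; exact: norm_rescale_le.
by move=> w; exact: rescale_continuous.
Qed.

Lemma unstraighten_continuous : continuous unstraighten.
Proof.
apply: rV_continuous => j.
have -> : (fun w => unstraighten w 0 j) =
    (fun w => - ((rescale e (w 0 1) (w 0 0))^-1 * w 0 (rev_ord j)) : C).
  by apply/funext => w; rewrite mxE.
apply: (scale_opp_continuous (M := 2)).
  move=> w; rewrite normfV -[leRHS]invrK lef_pV2 ?posrE ?invr_gt0 //.
    exact: norm_rescale_ge.
  by rewrite normr_gt0 rescale_neq0.
move=> w w0; apply: for_inv; last exact: rescale_neq0.
(* Precomposing with the swap of coordinates reduces this to [rescale_continuous]. *)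
pose sw (w : 'rV[C]_2) : 'rV[C]_2 := \row_j w 0 (rev_ord j).
have swc : continuous sw.
  apply: rV_continuous => i; have -> : (fun w => sw w 0 i) = (fun w => w 0 (rev_ord i)).
    by apply/funext => v; rewrite mxE.
  exact: coord_continuous.
have -> : (fun w => rescale e (w 0 1) (w 0 0) : C) =
    (fun w => rescale e (w 0 0) (w 0 1) : C) \o sw.
  by apply/funext => v; rewrite /= !mxE rev0 rev1.
apply: continuous_comp; first exact: swc.
apply: rescale_continuous; apply: contraNneq w0 => /rowP sw0.
by apply/eqP/rowP => i; have := sw0 (rev_ord i); rewrite !mxE rev_ordK.
Qed.

(** The map [straighten] is a homeomorphism of the whole plane; a small neighbourhood serves only to
    ensure [2 |v| <= |u|] on both curves, where [rescale_curve] applies. *)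
Lemma germ_top_equiv_straighten (A B : set 'rV[C]_2) p l :
  (0 < p)%N -> (l + e = p.+1)%N ->
  (forall w, A w <->
     (w 0 0 : K) ^+ p.+1 + (w 0 0 : K) ^+ l * (w 0 1 : K) ^+ e + (w 0 1 : K) ^+ p = 0) ->
  (forall w, B w <-> (w 0 0 : K) ^+ p = (w 0 1 : K) ^+ p.+1) ->
  germ_top_equiv A 0 B 0.
Proof.
move=> p0 lep AE BE.
(* The first coordinate of the image is [- s v] with [|s| >= 1/2], so this bound gives
   [|v| < 2^-(p+2)], as [curve_near0] requires. *)
pose V := [set w : 'rV[C]_2 | `|w 0 0 : K| < 2^-1 ^+ p.+3].
have straighten0 : straighten 0 = 0.
  by apply/rowP => j; rewrite !mxE mulr0 oppr0.
have d0 : 0 < 2^-1 ^+ p.+3 :> K by rewrite exprn_gt0 ?invr_gt0.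
have oV : open V.
  apply: (@open_comp _ C (fun w => w 0 0) [set z : C | `|z| < 2^-1 ^+ p.+3]).
    by move=> w _; exact: coord_continuous.
  rewrite (_ : [set z : C | _] = ball (0 : C) (2^-1 ^+ p.+3)); first exact: ball_open.
  by rewrite -ball_normE; apply/seteqP; split=> z /=; rewrite sub0r normrN.
have V0 : V 0 by rewrite /V /= mxE normr0.
exists (straighten @^-1` V), V, straighten, unstraighten; split.
- split; last by rewrite /preimage /= straighten0.
  by apply: open_comp => // w _; exact: straighten_continuous.
- by [].
- split.
  + by apply: continuous_subspaceT; exact: straighten_continuous.
  + by apply: continuous_subspaceT; exact: unstraighten_continuous.
  + apply/seteqP; split=> [_ [w Vw <-]//|w Vw].
    by exists (unstraighten w); rewrite ?unstraightenK // /preimage /= unstraightenK.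
  + apply/seteqP; split=> [_ [w Vw <-]|w Vw]; first by rewrite /preimage /= unstraightenK.
    by exists (straighten w) => //; rewrite straightenK.
  + by move=> w _; exact: straightenK.
- exact: straighten0.
suff AB w : V (straighten w) -> A w <-> B (straighten w).
  apply/seteqP; split=> [_ [w [Aw Vw] <-]|w [Bw Vw]].
    by split=> //; apply/AB.
  exists (unstraighten w); rewrite ?unstraightenK //; split; last first.
    by rewrite /preimage /= unstraightenK.
  by apply/AB; rewrite unstraightenK.
rewrite /V /= AE BE !mxE rev0 rev1 => Vw.
have s0 := rescale_neq0 (w 0 0 : K) (w 0 1) e0.
have curve_iff := rescale_curve p0 e0 lep.
move: Vw s0; set u : K := w 0 0; set v : K := w 0 1 => Vw s0.
split=> E.
  apply/curve_iff => //; apply: (curve_near0 lep) E.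
  move: Vw; rewrite normrN normrM => Vw.
  rewrite -(ltr_pM2l (x := 2^-1)) ?invr_gt0 // -exprS; apply: le_lt_trans Vw.
  by rewrite ler_wpM2r // norm_rescale_ge.
apply/curve_iff => //.
(* On the model the estimate holds for the image coordinates; the common factor [|s|] then
   cancels. *)
have : 2 * `|- (rescale e u v * v)| <= `|- (rescale e u v * u)|.
  apply: model_near0 E; apply: lt_le_trans Vw _.
  by rewrite ler_wiXn2l ?invr_ge0 // ?invf_le1 ?ler1n //; lia.
by rewrite !normrN !normrM mulrCA ler_pM2l // normr_gt0.
Qed.

End Homeo.

Local Open Scope complex_scope.
Local Open Scope ring_scope.

Theorem theorem1p1 (R : realType) (d d1 : nat)
    (hd1 : (2 <= d1)%N) (hd : (2 * d1 < d)%N) :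
  let d2 := (d - 1 - d1)%N in
  let x : {mpoly R[i][3]} := 'X_0 in
  let y : {mpoly R[i][3]} := 'X_1 in
  let z : {mpoly R[i][3]} := 'X_2 in
  let f := x ^+ d + x ^+ d1 * y ^+ (d2 + 1) + y ^+ (d - 1) * z in
  [/\ irreducible_mpoly f,
      free_with_exponents f d1 d2,
      rational_curve f
    & exists P, unique_cusp f P /\ unique_puiseux_pair f P (d - 1) d].
Proof.
move=> d2 x y z f.
(* The bounds [2 <= d1] and [2 * d1 < d] are traded for natural numbers [k = d1 - 2] and
   [m = d2 - d1]. *)
have [k d1E] : exists k, d1 = k.+2 by exists (d1 - 2)%N; lia.
have [m dE] : exists m, d = (k + k + m + 4).+1 by exists (d - 1 - 2 * d1)%N; lia.
have d2E : d2 = (k + m).+2 by rewrite /d2; lia.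
have d'E : (d - 1 = k + k + m + 4)%N by lia.
have fE : f = curve R[i] k m by rewrite /f d'E d2E addn1 dE d1E.
rewrite fE d2E d1E.
have dd' : coprime (d - 1) d by rewrite dE subn1 /= coprimenS.
split; first exact: irreducible_curve.
- exact: free_curve.
- exact: curve_rational.
exists (cusp R[i]); split.
  split; [exact: singular_cusp|exact: singular_point_curve|].
  move=> i /(local_equation_curve k m) ->.
  exact: irreducible_germ_local_curve.
split=> //; first by rewrite dE subn1.
move=> i /(local_equation_curve k m) ->.
apply: (@germ_top_equiv_straighten R[i] (k + m).+3 _ _ _ (k + k + m + 4) k.+2) => //.
- by rewrite addnS.
- by lia.
- by move=> w; rewrite /zero_locus /= local_curve_eval.
move=> w; rewrite /zero_locus /= d'E dE mevalB !rmorphXn /= !mevalXU.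
by split=> [/eqP|->]; rewrite ?subrr // subr_eq0 => /eqP.
Qed.
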